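(* Let $\gamma\in[0,2]$ and let $c\ge0$ be a constant. If $u:\mathbb{R}^d\to\mathbb{R}$ is a locally Lipschitz function satisfying, in the viscosity sense, $$\Delta_\infty^\gamma u-c\,|\nabla u|^{4-\gamma}\le0\quad\text{in }\mathbb{R}^d$$ and $\inf_{\mathbb{R}^d}u>-\infty$, then $u$ is necessarily a constant.
   Context: For a $C^2$ function $\varphi$, $\Delta_\infty^\gamma\varphi=|\nabla\varphi|^{-\gamma}\sum_{i,j=1}^d\partial_{x_i}\varphi\,\partial_{x_ix_j}\varphi\,\partial_{x_j}\varphi$. Viscosity sense: a lower-semicontinuous $u$ satisfies $\Delta_\infty^\gamma u+G(x,u,\nabla u)\le0$ in an open set $U\subset\mathbb{R}^d$ (with $G$ continuous) if, whenever $x_0\in U$ and $\varphi$ is $C^2$ near $x_0$ with $u(x_0)=\varphi(x_0)$ and $u>\varphi$ in a punctured ball around $x_0$, one has $\Delta_\infty^\gamma\varphi(x_0)+G(x_0,u(x_0),\nabla\varphi(x_0))\le0$; if $\nabla\varphi(x_0)=0$, the term $\Delta_\infty^\gamma\varphi(x_0)$ is read as $0$ when $\gamma<2$ and as $m(D^2\varphi(x_0))=\min_{|\xi|=1}\langle\xi,D^2\varphi(x_0)\xi\rangle$ when $\gamma=2$. *)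

(* Defs.v *)
From mathcomp Require Import all_boot all_order all_algebra.
From mathcomp Require Import all_classical all_reals all_analysis.

Set Implicit Arguments.
Unset Strict Implicit.
Unset Printing Implicit Defensive.

Import Order.TTheory GRing.Theory Num.Theory.
Import numFieldNormedType.Exports.

Local Open Scope classical_set_scope.
Local Open Scope ring_scope.

(* Points of R^d are row vectors 'rV[R]_d.  The library norm `|x| on this type
   is the sup norm: it gives the usual topology and the usual Lipschitz
   functions, but |xi| and |nabla phi| below are the Euclidean [enorm]. *)
Definition enorm (R : realType) (d : nat) (x : 'rV[R]_d) : R :=
  Num.sqrt (\sum_(i < d) x 0 i ^+ 2).

Definition partial (R : realType) (d : nat) (i : 'I_d) (phi : 'rV[R]_d -> R) :
    'rV[R]_d -> R :=
  fun x => 'D_(delta_mx 0 i) phi x.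

Definition grad (R : realType) (d : nat) (phi : 'rV[R]_d -> R) (x : 'rV[R]_d) :
    'rV[R]_d :=
  \row_(i < d) partial i phi x.

Definition hessian (R : realType) (d : nat) (phi : 'rV[R]_d -> R)
    (x : 'rV[R]_d) : 'M[R]_d :=
  \matrix_(i < d, j < d) partial i (partial j phi) x.

Definition C2_near (R : realType) (d : nat) (phi : 'rV[R]_d -> R)
    (x0 : 'rV[R]_d) : Prop :=
  \forall x \near x0,
    {for x, continuous phi} /\
    forall i : 'I_d,
      [/\ derivable phi x (delta_mx 0 i),
          {for x, continuous (partial i phi)} &
          forall j : 'I_d,
            derivable (partial i phi) x (delta_mx 0 j) /\
            {for x, continuous (partial j (partial i phi))}].

Definition inf_laplacian (R : realType) (d : nat) (gamma : R)
    (phi : 'rV[R]_d -> R) (x : 'rV[R]_d) : R :=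
  enorm (grad phi x) `^ (- gamma) *
  \sum_(i < d) \sum_(j < d)
    grad phi x 0 i * hessian phi x i j * grad phi x 0 j.

(* The infimum is attained, by compactness of the unit sphere, if d > 0. *)
Definition min_quad (R : realType) (d : nat) (M : 'M[R]_d) : R :=
  inf [set (xi *m M *m xi^T) 0 0 | xi in [set xi : 'rV[R]_d | enorm xi = 1]].

(* Value given to the gamma-infinity Laplacian of a test function; the else
   branch of [gamma < 2] is the case gamma = 2, as gamma ranges over [0, 2]. *)
Definition visc_inf_laplacian (R : realType) (d : nat) (gamma : R)
    (phi : 'rV[R]_d -> R) (x : 'rV[R]_d) : R :=
  if grad phi x == 0 then
    (if gamma < 2 then 0 else min_quad (hessian phi x))
  else inf_laplacian gamma phi x.

(* [visc_supersol gamma G U u]: u is lower semicontinuous and satisfies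
   Delta_oo^gamma u + G(x, u, nabla u) <= 0 in U in the viscosity sense
   (meant for U open and G continuous).  A test function is required to be
   C^2 only near x0, its values elsewhere being irrelevant. *)
Definition visc_supersol (R : realType) (d : nat) (gamma : R)
    (G : 'rV[R]_d -> R -> 'rV[R]_d -> R) (U : set 'rV[R]_d)
    (u : 'rV[R]_d -> R) : Prop :=
  (forall x, U x -> forall a : R, a < u x -> \forall y \near x, a < u y) /\
  forall (x0 : 'rV[R]_d) (phi : 'rV[R]_d -> R),
    U x0 -> C2_near phi x0 -> u x0 = phi x0 ->
    (\forall y \near x0^', phi y < u y) ->
    visc_inf_laplacian gamma phi x0 + G x0 (u x0) (grad phi x0) <= 0.

Definition locally_lipschitz (R : realType) (d : nat) (u : 'rV[R]_d -> R) :
    Prop :=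
  forall x : 'rV[R]_d, exists2 V, nbhs x V & [lipschitz u y | y in V].

(* Main.v *)
Require Import Defs.
From mathcomp Require Import all_boot all_order all_algebra.
From mathcomp Require Import all_classical all_reals all_analysis.
From mathcomp Require Import ring lra.
Import Order.TTheory GRing.Theory Num.Theory.
Import numFieldNormedType.Exports.
Local Open Scope classical_set_scope.
Local Open Scope ring_scope.

(** With C = c + 1, the radial cone w(r) = - a r + C a^2 r^2 is a strict
    subsolution wherever w' <> 0, i.e. for 0 < r < 1 / (2 C a), because
    w'' = 2 C a^2 > c a^2 >= c w'^2.  It drops by 1 / (4 C) on this interval,
    whatever a is.  So if u y < inf u + 1 / (4 C), then u - w(|x - y|) can be
    minimal on the ball of radius 1 / (2 C a) only at its centre, and
    u x >= u y - a |x - y| there; letting a -> 0, y is a global minimum of u.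
    Hence u takes no value strictly between min u and min u + 1 / (4 C), and it
    is constant by the intermediate value theorem along segments. *)

(** * Continuity of locally Lipschitz functions *)

Lemma locally_lipschitz_continuous (R : realType) (d : nat)
    (u : 'rV[R]_d -> R) : locally_lipschitz u -> continuous u.
Proof.
move=> ulip x; have [V Vx] := ulip x.
move=> [M0 [_ lipV]].
(* Every constant above M0 is a Lipschitz constant on V; the maximum with 1 makes M positive, so
   that e / M is a valid radius. *)
pose M := Num.max (M0 + 1) 1.
have M0M : M0 < M by rewrite lt_max ltrDl ltr01.
have M_gt0 : 0 < M by rewrite lt_max ltr01 orbT.
have uV y : V y -> `|u x - u y| <= M * `|x - y|.
  move=> Vy; apply: (lipV M M0M (x, y)); split => //=.
  exact: nbhs_singleton Vx.
apply/(@cvgrPdist_lt _ _ _ (nbhs x) (nbhs_filter x)) => e e0; near=> y.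
apply: le_lt_trans (uV y _) _; first by near: y.
rewrite mulrC -ltr_pdivlMr//; near: y.
move: (e / M) (divr_gt0 e0 M_gt0).
by apply/(@cvgrPdist_lt _ _ _ (nbhs x) (nbhs_filter x) id); exact: cvg_id.
Unshelve. all: by end_near. Qed.

(** * Euclidean inner product, norm and closed balls *)

Section dot.
Context {R : realType} {d : nat}.
Implicit Types x y z : 'rV[R]_d.

Definition dot x y : R := (x *m y^T) 0 0.

Lemma dotE x y : dot x y = \sum_i x 0 i * y 0 i.
Proof. by rewrite /dot mxE; apply: eq_bigr => i _; rewrite mxE. Qed.

Lemma dotC x y : dot x y = dot y x.
Proof. by rewrite !dotE; apply: eq_bigr => i _; rewrite mulrC. Qed.

Lemma dotDl x y z : dot (x + y) z = dot x z + dot y z.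
Proof. by rewrite /dot mulmxDl mxE. Qed.

Lemma dotZl (k : R) x z : dot (k *: x) z = k * dot x z.
Proof. by rewrite /dot -scalemxAl mxE. Qed.

Lemma dotDr x y z : dot z (x + y) = dot z x + dot z y.
Proof. by rewrite dotC dotDl !(dotC z). Qed.

Lemma dotZr (k : R) x z : dot z (k *: x) = k * dot z x.
Proof. by rewrite dotC dotZl dotC. Qed.

Lemma dot_delta x i : dot (delta_mx 0 i) x = x 0 i.
Proof.
rewrite dotE (bigD1 i)//= big1 ?addr0 => [|j ji]; rewrite mxE eqxx/=.
  by rewrite eqxx mul1r.
by rewrite (negbTE ji) mul0r.
Qed.

Lemma dot_ge0 x : 0 <= dot x x.
Proof. by rewrite dotE; apply: sumr_ge0 => i _; rewrite -expr2 sqr_ge0. Qed.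

Lemma dot_eq0 x : dot x x = 0 -> x = 0.
Proof.
rewrite dotE => /psumr_eq0P x0; apply/rowP => i; rewrite mxE.
have /eqP := x0 (fun j _ => sqr_ge0 (x 0 j)) i isT.
by rewrite mulf_eq0 orbb => /eqP.
Qed.

Lemma enormE x : enorm x = Num.sqrt (dot x x).
Proof. by rewrite dotE. Qed.

Lemma enorm_ge0 x : 0 <= enorm x.
Proof. exact: sqrtr_ge0. Qed.

Lemma sqr_enorm x : enorm x ^+ 2 = dot x x.
Proof. by rewrite enormE sqr_sqrtr// dot_ge0. Qed.

Lemma enorm_eq0 x : enorm x = 0 -> x = 0.
Proof. by move=> x0; apply: dot_eq0; rewrite -sqr_enorm x0 expr0n. Qed.

Lemma coord_le_enorm x i : `|x 0 i| <= enorm x.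
Proof.
rewrite -(sqrtr_sqr (x 0 i)) ler_wsqrtr// (bigD1 i)//= lerDl.
by apply: sumr_ge0 => j _; exact: sqr_ge0.
Qed.

Lemma norm_le_enorm x : `|x| <= enorm x.
Proof.
rewrite /Num.norm/= mx_normrE; apply: bigmax_le; first exact: enorm_ge0.
by case=> i j _; rewrite ord1; exact: coord_le_enorm.
Qed.

Lemma continuous_dot {F : set_system 'rV[R]_d} {FF : Filter F}
    (f g : 'rV[R]_d -> 'rV[R]_d) x y :
  f @ F --> x -> g @ F --> y -> (fun z => dot (f z) (g z)) @ F --> dot x y.
Proof.
move=> fx gy; rewrite dotE; under eq_cvg do rewrite dotE.
apply: cvg_big => [|i _]; first exact: add_continuous.
apply: cvgM.
  exact: (cvg_comp _ _ fx (@coord_continuous _ _ _ 0 i x)).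
exact: (cvg_comp _ _ gy (@coord_continuous _ _ _ 0 i y)).
Qed.

Lemma continuous_dotB x0 e : continuous (fun x => dot (x - x0) e).
Proof.
move=> x; apply: (continuous_dot (F := nbhs x) _ (cst e)); last exact: cvg_cst.
by apply: cvgB => //; exact: cvg_cst.
Qed.

Lemma continuous_dotBB x0 : continuous (fun x => dot (x - x0) (x - x0)).
Proof.
move=> x; apply: (continuous_dot (F := nbhs x)).
  by apply: cvgB => //; exact: cvg_cst.
by apply: cvgB => //; exact: cvg_cst.
Qed.

Lemma continuous_enormB y : continuous (fun x => enorm (x - y)).
Proof.
have -> : (fun x => enorm (x - y)) = Num.sqrt \o (fun x => dot (x - y) (x - y)).
  by apply/funext => z; exact: enormE.
move=> x; apply: continuous_comp; last exact: sqrt_continuous.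
exact: continuous_dotBB.
Qed.

(** Boundedness refers to the sup norm, which [enorm] dominates; closedness holds because the ball
    is the preimage of a closed half-line. *)
Lemma compact_closed_eball y (r : R) : compact [set x | enorm (x - y) <= r].
Proof.
apply: bounded_closed_compact.
  exists (r + `|y|); split; first exact: num_real.
  move=> M rM x /= xr.
  rewrite (le_trans _ (ltW rM))// -[x in `|x|](subrK y).
  by rewrite (le_trans (ler_normD _ _))// lerD2r (le_trans (norm_le_enorm _)).
apply: (@preimage_closed _ _ (fun x => enorm (x - y)) [set t | t <= r]).
  by move=> x _; exact: continuous_enormB.
exact: closed_le.
Qed.
End dot.

(** * Quadratic test functions and their derivatives *)

(** The difference quotient is exactly l + h m, which tends to l. Differentiating a quadratic thus
    reduces to a [ring] identity. *)
Lemma is_derive_quadratic (R : realType) (V : normedModType R) (f : V -> R)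
    (x v : V) (l m : R) :
  (forall h, f (h *: v + x) = f x + h * l + h ^+ 2 * m) -> is_derive x v f l.
Proof.
move=> fE.
have fl : h^-1 *: ((f \o shift x) (h *: v) - f x) @[h --> 0^'] --> l.
  have : l + h * m @[h --> (0 : R)^'] --> l + 0 * m.
    apply: cvgD; first exact: cvg_cst.
    by apply: cvgMl; apply: cvg_within_filter; exact: cvg_id.
  rewrite mul0r addr0; apply: cvg_trans; apply: near_eq_cvg.
  near=> h; rewrite /= fE /GRing.scale/=.
  have h0 : h != 0 by near: h; exact: nbhs_dnbhs_neq.
  by field.
by apply: DeriveDef; [apply: cvgP fl | apply: cvg_lim fl].
Unshelve. all: by end_near. Qed.

Lemma continuous_poly2 (R : realType) (T : topologicalType) (f g : T -> R)
    (a b c e : R) : continuous f -> continuous g ->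
  continuous (fun x => a + b * f x + c * g x + e * f x ^+ 2).
Proof.
move=> fc gc x; have fx := fc x; have gx := gc x.
apply: cvgD; last by apply: cvgMr; rewrite expr2; exact: cvgM.
apply: cvgD; last exact: cvgMr.
by apply: cvgD; [exact: cvg_cst | exact: cvgMr].
Qed.

Section quadratic_test_function.
Context {R : realType} {d : nat} (x0 e : 'rV[R]_d) (k P A B : R).

(** At x0 the gradient is P e and the Hessian is 2 A I + 2 B e e^T: the shape of the second-order
    expansion of a function of |x - y| when e is the radial direction at x0. *)
Definition quad (x : 'rV[R]_d) : R :=
  k + P * dot (x - x0) e + A * dot (x - x0) (x - x0) + B * dot (x - x0) e ^+ 2.

Definition quad1 (i : 'I_d) (x : 'rV[R]_d) : R :=
  (P + 2 * B * dot (x - x0) e) * e 0 i + 2 * A * (x - x0) 0 i.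

Definition quad2 (i j : 'I_d) : R :=
  2 * B * e 0 i * e 0 j + 2 * A * (i == j)%:R.

Lemma quad_x0 : quad x0 = k.
Proof.
rewrite /quad subrr -(scale0r (0 : 'rV[R]_d)) !dotZl !mul0r.
by rewrite expr0n !mulr0 !addr0.
Qed.

Lemma is_derive_quad i x : is_derive x (delta_mx 0 i) quad (quad1 i x).
Proof.
pose v : 'rV[R]_d := delta_mx 0 i.
apply: (@is_derive_quadratic _ _ _ _ _ _ (A * dot v v + B * e 0 i ^+ 2)) => h.
rewrite {}/v.
rewrite /quad /quad1 -(addrA (h *: _)); move: (x - x0) => z.
rewrite !(dotDl, dotDr, dotZl, dotZr) !(dotC _ (delta_mx 0 i)).
by rewrite !dot_delta; ring.
Qed.

Lemma partial_quad i : partial i quad = quad1 i.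
Proof.
by apply/funext => x; rewrite /partial; have [_ ->] := is_derive_quad i x.
Qed.

Lemma is_derive_quad1 i j x : is_derive x (delta_mx 0 j) (quad1 i) (quad2 i j).
Proof.
apply: (@is_derive_quadratic _ _ _ _ _ _ 0) => h.
rewrite /quad1 /quad2 -(addrA (h *: _)); move: (x - x0) => z.
rewrite dotDl dotZl dot_delta.
by rewrite !mxE eqxx/=; ring.
Qed.

Lemma partial_quad1 i j : partial j (quad1 i) = cst (quad2 i j).
Proof.
by apply/funext => x; rewrite /partial; have [_ ->] := is_derive_quad1 i j x.
Qed.

Lemma continuous_quad1 i : continuous (quad1 i).
Proof.
rewrite (_ : quad1 i = fun x => P * e 0 i + 2 * B * e 0 i * dot (x - x0) e
    + 2 * A * dot (x - x0) (delta_mx 0 i) + 0 * dot (x - x0) e ^+ 2).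
  by apply: continuous_poly2; exact: continuous_dotB.
apply/funext => x.
by rewrite /quad1 -(dot_delta (x - x0)) (dotC (delta_mx _ _)); ring.
Qed.

Lemma continuous_quad : continuous quad.
Proof.
by apply: continuous_poly2; [exact: continuous_dotB | exact: continuous_dotBB].
Qed.

Lemma C2_near_quad : C2_near quad x0.
Proof.
near=> x; split=> [|i]; first exact: continuous_quad.
split=> [||j]; rewrite ?partial_quad.
- by have [] := is_derive_quad i x.
- exact: continuous_quad1.
- split; first by have [] := is_derive_quad1 i j x.
  by rewrite partial_quad1; exact: cst_continuous.
Unshelve. all: by end_near. Qed.

Lemma grad_quad : grad quad x0 = P *: e.
Proof.
apply/rowP => i; rewrite !mxE partial_quad /quad1 subrr mxE mulr0 addr0.
by rewrite -(scale0r e) dotZl mul0r mulr0 addr0.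
Qed.

Lemma hessian_quad i j : hessian quad x0 i j = quad2 j i.
Proof. by rewrite mxE partial_quad partial_quad1. Qed.

Lemma enorm_grad_quad : dot e e = 1 -> enorm (grad quad x0) = `|P|.
Proof.
by move=> e1; rewrite grad_quad enormE dotZl dotZr e1 mulr1 -expr2 sqrtr_sqr.
Qed.

(** The gradient P e is an eigenvector of the Hessian with eigenvalue 2 (A + B), and P <> 0 rules
    out the convention for vanishing gradients. *)
Lemma visc_inf_laplacian_quad gamma : dot e e = 1 -> P != 0 ->
  visc_inf_laplacian gamma quad x0
  = `|P| `^ (- gamma) * (P ^+ 2 * (2 * (A + B))).
Proof.
move=> e1 P0; rewrite /visc_inf_laplacian ifF; last first.
  apply/eqP => g0; have := enorm_grad_quad e1.
  rewrite g0 enormE -(scale0r e) dotZl mul0r sqrtr0 => /esym/normr0_eq0/eqP.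
  exact/negP.
rewrite /inf_laplacian enorm_grad_quad//; congr (_ * _).
have inner i : \sum_j e 0 j * quad2 j i = 2 * (A + B) * e 0 i.
  transitivity (2 * B * e 0 i * dot e e + 2 * A * e 0 i); last first.
    by rewrite e1; ring.
  rewrite dotE mulr_sumr
    [X in _ + X](_ : _ = \sum_j 2 * A * e 0 j * (j == i)%:R).
    by rewrite -big_split/=; apply: eq_bigr => j _; rewrite /quad2; ring.
  rewrite (bigD1 i)//= eqxx mulr1 big1 ?addr0// => j /negbTE ->.
  by rewrite mulr0.
transitivity (P ^+ 2 * (2 * (A + B)) * dot e e); last by rewrite e1 mulr1.
rewrite dotE mulr_sumr; apply: eq_bigr => i _.
transitivity (P ^+ 2 * e 0 i * \sum_j e 0 j * quad2 j i).
  rewrite mulr_sumr; apply: eq_bigr => j _.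
  by rewrite hessian_quad grad_quad !mxE; ring.
by rewrite inner; ring.
Qed.

End quadratic_test_function.

(** * Second-order upper bound for the Euclidean distance *)

(** Cauchy-Schwarz: the component of x orthogonal to e has nonnegative squared length. *)
Lemma sqr_dot_le (R : realType) (d : nat) (x e : 'rV[R]_d) :
  dot e e = 1 -> dot x e ^+ 2 <= dot x x.
Proof.
move=> e1; have := dot_ge0 (x + - dot x e *: e).
by rewrite !(dotDl, dotDr, dotZl, dotZr) e1 (dotC e x); lra.
Qed.

Lemma sqr_enormB_expand (R : realType) (d : nat) (y x0 x : 'rV[R]_d) (r : R) :
  (r == 0) = false -> enorm (x0 - y) = r ->
  enorm (x - y) ^+ 2 = dot (x - x0) (x - x0)
    + 2 * r * dot (x - x0) (r^-1 *: (x0 - y)) + r ^+ 2.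
Proof.
move=> r0 rE; have zz : dot (x0 - y) (x0 - y) = r ^+ 2 by rewrite -sqr_enorm rE.
rewrite sqr_enorm -[x - y](subrKA x0); move: (x - x0) (x0 - y) zz => h z zz.
rewrite !(dotDl, dotDr, dotZl, dotZr) (dotC z h) zz.
by field; rewrite r0.
Qed.

(* Second-order Taylor expansion of the Euclidean distance to y, with error term
   kappa |x - x0|^2; e is the unit radial direction at x0. *)
Lemma enorm_taylor_le (R : realType) (d : nat) (y x0 : 'rV[R]_d)
    (r kappa : R) :
  0 < r -> 0 < kappa -> enorm (x0 - y) = r ->
  let e := r^-1 *: (x0 - y) in
  \forall x \near x0, enorm (x - y) <=
    r + dot (x - x0) e
    + (dot (x - x0) (x - x0) - dot (x - x0) e ^+ 2) / (2 * r)
    + kappa * dot (x - x0) (x - x0).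
Proof.
move=> r0 k0 rE e.
have e1 : dot e e = 1.
  by rewrite dotZl dotZr -sqr_enorm rE; field; rewrite gt_eqF.
(* With t = (x - x0).e, the bound |t| < r keeps r + t positive, and |t| (1/r + 2 kappa) < 2 r kappa
   lets the error term absorb the cross term in the squared inequality. *)
pose del := Num.min r (2 * r * kappa / (r^-1 + 2 * kappa)).
have rV0 : 0 < r^-1 by rewrite invr_gt0.
have den0 : 0 < r^-1 + 2 * kappa by nra.
have del0 : 0 < del by rewrite lt_min r0/= divr_gt0// !mulr_gt0.
have : \forall x \near x0, `|dot (x0 - x0) e - dot (x - x0) e| < del.
  have := continuous_dotB x0 e x0.
  by move=> /(@cvgrPdist_lt _ _ _ (nbhs x0) (nbhs_filter x0)); apply.
apply: filterS => x; rewrite subrr -{1}(scale0r e) dotZl mul0r sub0r normrN.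
rewrite lt_min ltr_pdivlMr// => /andP[tr tk].
have tq := sqr_dot_le _ _ (x - x0) e e1.
have sE := sqr_enormB_expand _ _ y x0 x _ (gt_eqF r0) rE.
rewrite -/e in sE.
move: tr tk tq sE; set t := dot _ e; set q := dot _ _ => tr tk tq sE.
have q0 : 0 <= q by exact: dot_ge0.
have T2 : (q - t ^+ 2) / (2 * r) = (q - t ^+ 2) * r^-1 / 2.
  by field; rewrite gt_eqF.
rewrite T2; set w := r^-1 in rV0 den0 tk *.
have rw : r * w = 1 by rewrite /w divff// gt_eqF.
have := enorm_ge0 (x - y).
move: sE; set s := enorm _ => sE s0.
clearbody w t q s; pose X := (q - t ^+ 2) * w / 2.
have X0 : 0 <= X by rewrite !mulr_ge0// ?subr_ge0// ltW.
have rX : 2 * r * X = q - t ^+ 2.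
  rewrite /X; transitivity ((r * w) * (q - t ^+ 2)); first by field.
  by rewrite rw mul1r.
have XY : 2 * (X + kappa * q) <= q * (w + 2 * kappa).
  have : 0 <= t ^+ 2 * w by rewrite mulr_ge0 ?sqr_ge0// ltW.
  by rewrite /X; lra.
have Y0 : 0 <= X + kappa * q by rewrite addr_ge0// mulr_ge0// ltW.
have rY : 2 * r * (X + kappa * q) = q - t ^+ 2 + 2 * r * kappa * q.
  by rewrite mulrDr rX; ring.
rewrite -/X -addrA; move: (X + kappa * q) Y0 XY rY => Y Y0 XY rY.
have tt : - `|t| <= t by rewrite lerNl -normrN ler_norm.
(* Both sides are nonnegative. After squaring, what remains is 0 <= 2 r kappa q + 2 t Y + Y^2, where
   Y is the second-order term plus the error. *)
rewrite -(ler_pXn2r (n := 2))// ?nnegrE//; last by lra.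
have tY : - `|t| * (2 * Y) <= t * (2 * Y) by apply: ler_wpM2r => //; lra.
have tY2 : `|t| * (2 * Y) <= `|t| * (q * (w + 2 * kappa)) by apply: ler_wpM2l.
have tY3 : q * (`|t| * (w + 2 * kappa)) <= q * (2 * r * kappa).
  by apply: ler_wpM2l => //; exact: ltW.
have Y2 := sqr_ge0 Y.
have -> : (r + t + Y) ^+ 2
    = r ^+ 2 + 2 * r * t + t ^+ 2 + 2 * r * Y + t * (2 * Y) + Y ^+ 2.
  by ring.
rewrite sE rY; lra.
Qed.

(** * Comparison with radial cones *)

Lemma cone_comparison (R : realType) (d : nat) (gamma c : R)
    (u : 'rV[R]_d -> R) (m a : R) (y : 'rV[R]_d) :
  0 <= c -> continuous u ->
  visc_supersol gamma (fun _ _ p => - (c * enorm p `^ (4 - gamma))) setT u ->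
  (forall x, m <= u x) -> u y < m + (4 * (c + 1))^-1 -> 0 < a ->
  forall x, enorm (x - y) <= (2 * (c + 1) * a)^-1 ->
  u y - a * enorm (x - y) <= u x.
Proof.
move=> c0 cu [_ visc] mu uy a0.
set C := c + 1; set rho := (2 * C * a)^-1; pose b := C * a ^+ 2.
have C0 : 0 < C by rewrite /C; lra.
have b0 : 0 < b by rewrite /b mulr_gt0// exprn_gt0.
have rho0 : 0 < rho by rewrite invr_gt0 !mulr_gt0.
have C_neq0 : C != 0 by rewrite gt_eqF.
have a_neq0 : a != 0 by rewrite gt_eqF.
have enorm0 : enorm (y - y) = 0.
  by rewrite subrr enormE -(scale0r y) dotZl mul0r sqrtr0.
pose f x := u x + a * enorm (x - y) + (- b) * enorm (x - y) ^+ 2.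
have cf : continuous f.
  rewrite (_ : f = fun x => 0 + a * enorm (x - y) + 1 * u x
      + (- b) * enorm (x - y) ^+ 2).
    by apply: continuous_poly2; [exact: continuous_enormB | exact: cu].
  by apply/funext => z; rewrite /f; ring.
(* Let x0 minimise f = u - w(|x - y|) on the closed ball. If x0 is the centre, the claim follows by
   dropping b |x - y|^2 >= 0; the sphere and the rest of the interior are excluded in turn. *)
have [||x0 x0r fx0] := EVT_min_rV (f := f) _ (compact_closed_eball y rho).
- by exists y; rewrite /= enorm0 ltW.
- exact: continuous_subspaceT.
have {}fx0 x : enorm (x - y) <= rho -> f x0 <= f x.
  by move=> xr; apply: fx0; rewrite inE.
have {}x0r : enorm (x0 - y) <= rho by move: x0r; rewrite inE.
have fy : f y = u y by rewrite /f enorm0 expr0n/= !mulr0 !addr0.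
have [r rE] : {r | enorm (x0 - y) = r} by exists (enorm (x0 - y)).
have r_ge0 : 0 <= r by rewrite -rE enorm_ge0.
have [r_eq0|r_neq0] := eqVneq r 0.
  have x0y : x0 = y.
    by apply/eqP; rewrite -subr_eq0; apply/eqP/enorm_eq0; rewrite rE.
  move=> x xr; have := fx0 x xr; rewrite x0y fy /f.
  by have := mulr_ge0 (ltW b0) (sqr_ge0 (enorm (x - y))); lra.
have r0 : 0 < r by rewrite lt_def r_neq0.
exfalso.
(* On the sphere w = - 1 / (4 C), so f x0 <= f y gives u y >= u x0 + 1 / (4 C) >= m + 1 / (4 C),
   against the choice of y. *)
have [r_eq|r_neq] := eqVneq r rho.
  have := fx0 y; rewrite enorm0 fy /f rE r_eq => /(_ (ltW rho0)).
  have -> : a * rho = (4 * C)^-1 * 2 by rewrite /rho; field; rewrite C_neq0.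
  have -> : - b * rho ^+ 2 = - (4 * C)^-1.
    by rewrite /rho /b; field; rewrite C_neq0.
  by have := mu x0; lra.
have r_lt : r < rho by rewrite lt_neqAle r_neq -rE.
(* This value makes 2 (A + B) = 2 b - 4 a kappa = C a^2 below, which still exceeds c a^2. *)
pose kappa := C * a / 4.
have kappa0 : 0 < kappa by rewrite divr_gt0// mulr_gt0.
pose e := r^-1 *: (x0 - y).
have e1 : dot e e = 1.
  rewrite /e dotZl dotZr -sqr_enorm rE; by field.
(* P = w'(r) lies strictly between - a and 0, so the test function has nonzero gradient and P^2 <=
   a^2. *)
pose P := - a + 2 * b * r.
have P_lt0 : P < 0.
  have : 2 * b * r < 2 * b * rho by rewrite ltr_pM2l// mulr_gt0.
  have -> : 2 * b * rho = a by rewrite /b /rho; field; rewrite C_neq0 a_neq0.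
  by rewrite /P; lra.
have P_gta : - a < P by rewrite /P ltrDl !mulr_gt0.
pose B := a / (2 * r); pose A := b - B - 2 * a * kappa.
(* The quadratic Taylor polynomial of the cone at x0, lowered by
   2 a kappa |x - x0|^2: half of this absorbs the Taylor error, the other half
   makes the contact strict. *)
have touch : \forall x \near x0^', quad x0 e (u x0) P A B x < u x.
  have near1 := enorm_taylor_le _ _ y x0 r kappa r0 kappa0 rE.
  have near2 : \forall x \near x0, enorm (x - y) < rho.
    have := continuous_enormB y x0.
    move=> /(@cvgrPdist_lt _ _ _ (nbhs x0) (nbhs_filter x0)) /(_ (rho - r)).
    rewrite subr_gt0 => /(_ r_lt); apply: filterS => x; rewrite rE.
    by rewrite ltr_norml => /andP[]; lra.
  apply: (@filterS _ _ (nbhs_filter x0) _ _ _ (filterI near1 near2)).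
  move=> x /= [xT xrho] /eqP xx0.
  move: xT; have := fx0 x (ltW xrho).
  rewrite /f rE (sqr_enormB_expand _ _ y x0 x r)//; last exact/negbTE.
  rewrite /quad -/e; set t := dot (x - x0) e; set q := dot (x - x0) (x - x0).
  have q0 : 0 < q.
    rewrite lt_def dot_ge0 andbT; apply: contra_notN xx0 => /eqP/dot_eq0/eqP.
    by rewrite subr_eq0 => /eqP.
  move: (enorm (x - y)) => s fx xT.
  have := ler_wpM2l (ltW a0) xT.
  have -> : a * (r + t + (q - t ^+ 2) / (2 * r) + kappa * q)
      = a * r + a * t + B * (q - t ^+ 2) + a * kappa * q.
    by rewrite /B; field.
  have := mulr_gt0 (mulr_gt0 a0 kappa0) q0.
  rewrite /P /A; lra.
have := visc x0 (quad x0 e (u x0) P A B) Logic.I (C2_near_quad _ _ _ _ _ _).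
rewrite quad_x0 => /(_ erefl touch).
have P_neq0 : P != 0 by rewrite lt_eqF.
rewrite visc_inf_laplacian_quad// enorm_grad_quad//.
have nP0 : 0 < `|P| by rewrite normr_gt0.
(* Both terms carry the factor |P|^(- gamma) = 1 / W > 0. Once it is removed, gamma disappears and
   only the sign of C a^2 - c P^2 matters. *)
rewrite powRB; last by rewrite (gt_eqF nP0) implybT.
rewrite powRN powR_mulrn//; set W := `|P| `^ gamma.
have W0 : 0 < W by rewrite powR_gt0.
have -> : `|P| ^+ 4 = P ^+ 4 by rewrite -normrX ger0_norm// exprn_even_ge0.
have -> : W^-1 * (P ^+ 2 * (2 * (A + B))) - c * (P ^+ 4 / W)
    = (P ^+ 2 * (C * a ^+ 2 - c * P ^+ 2)) / W.
  by rewrite /A /kappa /b; field; rewrite gt_eqF.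
rewrite pmulr_lle0 ?invr_gt0//.
have P2 : 0 < P ^+ 2 by rewrite exprn_even_gt0.
rewrite pmulr_rle0//.
have : c * P ^+ 2 <= c * a ^+ 2 by apply: ler_wpM2l => //; nra.
have : 0 < a ^+ 2 by rewrite exprn_gt0.
by rewrite /C; lra.
Qed.

(** * From almost minimal values to constancy *)

(** The lower bound m is arbitrary because the theorem takes it first as the infimum of u, then as
    the attained minimum. *)
Lemma almost_min_is_min (R : realType) (d : nat) (gamma c : R)
    (u : 'rV[R]_d -> R) (m : R) (y : 'rV[R]_d) :
  0 <= c -> continuous u ->
  visc_supersol gamma (fun _ _ p => - (c * enorm p `^ (4 - gamma))) setT u ->
  (forall x, m <= u x) -> u y < m + (4 * (c + 1))^-1 ->
  forall x, u y <= u x.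
Proof.
move=> c0 cu visc mu uy x; rewrite leNgt; apply/negP => uxy.
pose s := enorm (x - y); have s0 : 0 <= s := enorm_ge0 _.
(* One small slope replaces the limit a -> 0: the first bound gives a s < u y - u x, the second puts
   x in the ball where the cone estimate holds. *)
pose a := Num.min ((u y - u x) / (2 * (s + 1))) (2 * (c + 1) * (s + 1))^-1.
have a0 : 0 < a by rewrite lt_min divr_gt0 ?invr_gt0 ?mulr_gt0//; lra.
have : a <= (u y - u x) / (2 * (s + 1)) by rewrite ge_min lexx.
rewrite ler_pdivlMr; last by lra.
have : a <= (2 * (c + 1) * (s + 1))^-1 by rewrite ge_min lexx orbT.
rewrite -[_^-1]mul1r ler_pdivlMr; last by rewrite !mulr_gt0//; lra.
move=> as1 as2.
have sa : s <= (2 * (c + 1) * a)^-1.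
  rewrite -[_^-1]mul1r ler_pdivlMr; last by rewrite !mulr_gt0//; lra.
  have : 0 < (c + 1) * a by rewrite mulr_gt0//; lra.
  by lra.
have := cone_comparison _ _ gamma c u m a y c0 cu visc mu uy a0 x sa.
by rewrite -/s; lra.
Qed.

Lemma continuous_segment (R : realType) (V : normedModType R) (x y : V) :
  continuous (fun t : R => t *: (x - y) + y).
Proof.
move=> t; apply: cvgD; last exact: cvg_cst.
exact: scalel_continuous.
Qed.

Theorem theorem2p4 (R : realType) (d : nat) (gamma c : R)
    (u : 'rV[R]_d -> R) :
  0 <= gamma <= 2 ->
  0 <= c ->
  locally_lipschitz u ->
  visc_supersol gamma (fun _ _ p => - (c * enorm p `^ (4 - gamma))) setT u ->
  (-oo < ereal_inf (range (fun x => (u x)%:E)))%E ->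
  exists k : R, forall x : 'rV[R]_d, u x = k.
Proof.
move=> _ c0 /locally_lipschitz_continuous cu visc infu.
have eps0 : 0 < (4 * (c + 1))^-1 :> R by rewrite invr_gt0 mulr_gt0//; lra.
have lbu x : (ereal_inf (range (fun x => (u x)%:E)) <= (u x)%:E)%E.
  by apply: ereal_inf_lbound; exists x.
have hinf : has_inf (range u).
  split; first by exists (u 0), 0.
  case: (ereal_inf _) infu lbu => [l _ lbu|_ lbu|//].
  - by exists l => _ [x _ <-]; rewrite -lee_fin.
  - by have := lbu 0.
have [_ [y _ <-] uy] := inf_adherent eps0 hinf.
have ymin : forall x, u y <= u x.
  apply: (almost_min_is_min _ _ gamma c u (inf (range u)) y) => // x.
  by apply: ge_inf; [case: hinf | exists x].
exists (u y) => x; apply/eqP; rewrite eq_le ymin andbT leNgt; apply/negP => uyx.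
(* A value above the minimum u y, attained on the segment from y to x, and below the threshold: a
   point where u = v would be a global minimum, forcing v <= u y. *)
pose v := Num.min (u x) (u y + (4 * (c + 1))^-1 / 2).
have [||t _ tv] := @IVT R (fun t => u (t *: (x - y) + y)) 0 1 v ler01.
- apply: continuous_subspaceT => t.
  by apply: continuous_comp; [exact: continuous_segment | exact: cu].
- rewrite scale0r add0r scale1r subrK (min_idPl (ltW uyx)) (max_idPr (ltW uyx)).
  rewrite /v ge_min lexx/= le_min (ltW uyx)/=; lra.
have : v <= u y.
  rewrite -tv; apply: (almost_min_is_min _ _ gamma c u (u y)) => //.
  rewrite tv /v gt_min; apply/orP; right; lra.
rewrite leNgt /v lt_min uyx/= => /negP; apply; lra.
Qed.
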